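(* Let $G$ be a bridgeless cubic graph (multiple edges and loops permitted) with colouring defect $\operatorname{df}(G)=3$. Then $G$ admits a Berge cover, that is, there exist at most five perfect matchings of $G$ whose union contains every edge of $G$.
   Context: The colouring defect $\operatorname{df}(G)$ of a bridgeless cubic graph $G$ is the minimum, over all collections $\{M_1,M_2,M_3\}$ of three (not necessarily distinct) perfect matchings of $G$, of the number of edges of $G$ belonging to none of $M_1,M_2,M_3$. *)

(* Defs.v *)
(* A multigraph (loops and parallel edges allowed) is given by
   a finite vertex type V, a finite edge type E and an endpoint map
   ends : E -> V * V (the order of the two endpoints is irrelevant). *)
From mathcomp Require Import all_boot.
Set Implicit Arguments. Unset Strict Implicit. Unset Printing Implicit Defensive.

Section Multigraph.
Variables (V E : finType) (ends : E -> V * V).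

(* degree of v inside the edge set F, a loop at v counting twice *)
Definition sdeg (F : {set E}) (v : V) : nat :=
  #|[set e in F | (ends e).1 == v]| + #|[set e in F | (ends e).2 == v]|.

Definition cubic : Prop := forall v : V, sdeg setT v = 3.

Definition adj_without (e : E) : rel V :=
  fun u w => [exists f : E, (f != e) && ((ends f == (u, w)) || (ends f == (w, u)))].

Definition bridge (e : E) : bool :=
  ~~ connect (adj_without e) (ends e).1 (ends e).2.

Definition bridgeless : Prop := forall e : E, ~~ bridge e.

(* perfect matching: every vertex has degree exactly 1 in M
   (this forbids loops in M, since a loop contributes 2) *)
Definition perfect_matching (M : {set E}) : Prop := forall v : V, sdeg M v = 1.

Definition uncovered (M1 M2 M3 : {set E}) : nat := #|~: (M1 :|: M2 :|: M3)|.

Definition colouring_defect (k : nat) : Prop :=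
  (exists M1 M2 M3, [/\ perfect_matching M1, perfect_matching M2,
                        perfect_matching M3 & uncovered M1 M2 M3 = k]) /\
  (forall M1 M2 M3, perfect_matching M1 -> perfect_matching M2 ->
                    perfect_matching M3 -> k <= uncovered M1 M2 M3).

Definition berge_cover : Prop :=
  exists s : seq {set E},
    [/\ size s <= 5, (forall M, M \in s -> perfect_matching M) &
        forall e : E, exists2 M, M \in s & e \in M].
End Multigraph.

(* Main.v *)
(* Three optimal perfect matchings M1, M2, M3 leave uncovered the three alternate edges of a
   hexagon v0 ... v5, the other three edges lying in {M1, M2}, {M2, M3} and {M3, M1}: any other
   configuration contains a cycle along which one of the M_i can be switched to cover more.
   Since every edge lies in a perfect matching, it suffices to find a perfect matching
   containing two of the uncovered edges. If v0v1 and v2v3 lie in no common perfect matching,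
   counting edges around a Tutte barrier yields a 3-edge-cut whose odd side (an ear) meets the
   hexagon exactly in {v4, v5}. If this happens for all three pairs, minimal ears are pairwise
   disjoint by uncrossing, and exchanging two colours inside each ear gives a
   3-edge-colouring, contradicting the optimality of M1, M2, M3. *)
Require Import Defs.
From mathcomp Require Import all_boot zify.
Set Implicit Arguments. Unset Strict Implicit. Unset Printing Implicit Defensive.

(* [lia] on the goal alone, with graph-theoretic quantities turned into variables:
   comparing them up to conversion would unfold enumerations of finite types. *)
Ltac nlia :=
  repeat match goal with
  | |- context [@bigop ?R ?I ?x ?r ?F] => generalize (@bigop R I x r F)
  | |- context [@card ?T ?A] => generalize (@card T A)
  | |- context [@in_mem ?T ?x ?A] => generalize (@in_mem T x A)
  | |- context [Defs.sdeg ?g ?F ?v] => generalize (Defs.sdeg g F v)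
  end;
  clear; lia.

(** The barrier count yields structure because it is tight. Let U = {v0, v1, v2, v3}. Parity gives
    at least |S| + 2 odd pieces, each with at least 3 cut edges, while S and U carry only 3|S| + 12
    edge ends, 6 of them spent inside U by the path v0 v1 v2 v3. Nothing is left over: every piece
    has exactly 3 cut edges, and the hexagon edges from U to v4 and v5 run into pieces.

    The cut of the resulting ear consists of v5v0, v3v4 and one more edge, which parity places in M3
    alone. So M1 and M2 meet this cut in one hexagon edge each, and exchanging them inside the ear
    is consistent everywhere except at the hexagon. There each matching takes up one uncovered edge
    and gives up the two hexagon edges next to it, whose far ends lie in the two neighbouring ears;
    the exchange inside those ears makes up for the loss. This is why three disjoint ears are wanted
    at once. *)

Section Multigraph.
Variables (V E : finType) (ends : E -> V * V).
Implicit Types (e f : E) (u v w : V) (X Y A S : {set V}) (F M N : {set E}).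

(** * Incidence, cuts and double counting *)

Notation sdeg := (sdeg ends).

Definition inc e v : nat := ((ends e).1 == v) + ((ends e).2 == v).
Definition nends e X : nat := ((ends e).1 \in X) + ((ends e).2 \in X).
Definition cut X : {set E} := [set e | ((ends e).1 \in X) != ((ends e).2 \in X)].
Definition joins e u w : bool := (ends e == (u, w)) || (ends e == (w, u)).

Lemma joins_ends e : joins e (ends e).1 (ends e).2.
Proof. by rewrite /joins -surjective_pairing eqxx. Qed.

Lemma joinsC e u w : joins e u w = joins e w u.
Proof. by rewrite /joins orbC. Qed.

Lemma joins_inc e u w v : joins e u w -> inc e v = (u == v) + (w == v).
Proof. by rewrite /inc => /orP[]/eqP-> //=; rewrite addnC. Qed.

Lemma joins_nends e u w X : joins e u w -> nends e X = (u \in X) + (w \in X).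
Proof. by rewrite /nends => /orP[]/eqP-> //=; rewrite addnC. Qed.

Lemma joins_cut e u w X : joins e u w -> (e \in cut X) = ((u \in X) != (w \in X)).
Proof. by rewrite inE => /orP[]/eqP-> //=; rewrite eq_sym. Qed.

Lemma sdegE F v : sdeg F v = \sum_(e in F) inc e v.
Proof.
rewrite big_split /=; congr (_ + _).
  by rewrite -sum1_card big_mkcond [RHS]big_mkcond; apply: eq_bigr => e _;
  rewrite !inE; case: (e \in F); case: eqP.
by rewrite -sum1_card big_mkcond [RHS]big_mkcond; apply: eq_bigr => e _;
  rewrite !inE; case: (e \in F); case: eqP.
Qed.

Lemma sum_inc e X : \sum_(v in X) inc e v = nends e X.
Proof.
have sum_eq a : \sum_(v in X) (a == v) = (a \in X).
  case: (boolP (a \in X)) => aX.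
    by rewrite (bigD1 a) //= eqxx big1 // => v /andP[_ /negPf]; rewrite eq_sym => ->.
  by rewrite big1 // => v vX; case: eqP => // av; rewrite av vX in aX.
by rewrite big_split /= !sum_eq.
Qed.

Lemma sum_sdeg F X : \sum_(v in X) sdeg F v = \sum_(e in F) nends e X.
Proof.
under eq_bigr do rewrite sdegE.
by rewrite exchange_big /=; apply: eq_bigr => e _; rewrite sum_inc.
Qed.

(** An edge inside [X] contributes 2 to the degree sum and a cut edge 1, so only cut edges survive
    modulo 2. *)
Lemma odd_sum_sdeg F X : odd (\sum_(v in X) sdeg F v) = odd #|F :&: cut X|.
Proof.
have -> : #|F :&: cut X| = \sum_(e in F) (e \in cut X).
  rewrite -sum1_card [LHS]big_mkcond [RHS]big_mkcond; apply: eq_bigr => e _.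
  by rewrite in_setI; do 2!case: (_ \in _).
rewrite sum_sdeg; elim/big_rec2: _ => // e a b _ IH; rewrite !oddD IH inE /nends.
by do 2!case: (_ \in X).
Qed.

Lemma sdegU F M v : [disjoint F & M] -> sdeg (F :|: M) v = sdeg F v + sdeg M v.
Proof. by move=> FM; rewrite !sdegE -bigU //=; apply: eq_bigl => e; rewrite !inE. Qed.

Lemma sdeg1 e v : sdeg [set e] v = inc e v.
Proof. by rewrite sdegE big_set1. Qed.

Lemma eq_sdeg F M v : (forall e, 0 < inc e v -> (e \in F) = (e \in M)) -> sdeg F v = sdeg M v.
Proof.
move=> FM; rewrite !sdegE big_mkcond [RHS]big_mkcond; apply: eq_bigr => e _.
by have [->|/FM->//] := posnP (inc e v); rewrite !if_same.
Qed.

(** * Tutte-Berge formula *)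

(** The bound is 0 off [A], so these are the matchings of the subgraph induced by [A]; loops are
    excluded because they count twice. *)
Definition matching A M : bool := [forall v, sdeg M v <= (v \in A)].

Definition max_matching A M : bool :=
  matching A M && [forall N : {set E}, matching A N ==> (#|N| <= #|M|)].

Lemma matchingP A M : reflect (forall v, sdeg M v <= (v \in A)) (matching A M).
Proof. exact: forallP. Qed.

Lemma max_matchingP A M :
  reflect (matching A M /\ forall N, matching A N -> #|N| <= #|M|) (max_matching A M).
Proof.
apply: (iffP andP) => -[MM H]; split=> //; first by move=> N; move/forallP/(_ N)/implyP: H.
by apply/forallP => N; apply/implyP/H.
Qed.

Lemma matching0 A : matching A set0.
Proof. by apply/matchingP => v; rewrite sdegE big_set0. Qed.

Lemma max_matching_exists A : exists M, max_matching A M.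
Proof.
case: (arg_maxnP (fun M : {set E} => #|M|) (matching0 A)) => M MM Mmax.
by exists M; apply/max_matchingP.
Qed.

Lemma inc_le_sdeg e F v : e \in F -> inc e v <= sdeg F v.
Proof. by move=> eF; rewrite sdegE (bigD1 e) //= leq_addr. Qed.

Lemma sdeg_gt0P F v : reflect (exists2 e, e \in F & 0 < inc e v) (0 < sdeg F v).
Proof.
apply: (iffP idP) => [|[e eF]]; last by move/leq_trans; apply; apply: inc_le_sdeg.
rewrite sdegE => H; apply/exists_inP; apply: contraLR H => /exists_inPn H.
by rewrite -leqNgt leqn0; apply/eqP; apply: big1 => e /H; rewrite -leqNgt leqn0 => /eqP.
Qed.

Lemma inc_gt0P e v : 0 < inc e v -> exists w, joins e v w.
Proof.
have := joins_ends e; rewrite /inc; case: eqP => [<- ee _|_ ee]; first by exists (ends e).2.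
by case: eqP => // <- _; exists (ends e).1; rewrite joinsC.
Qed.

Lemma sdegU1 e F v : e \notin F -> sdeg (e |: F) v = inc e v + sdeg F v.
Proof. by move=> eF; rewrite sdegU ?sdeg1 // disjoints1. Qed.

Lemma sdegD1 e F v : e \in F -> sdeg F v = inc e v + sdeg (F :\ e) v.
Proof. by move=> eF; rewrite -sdegU1 ?setD1K // !inE eqxx. Qed.

Lemma matching_joins A M e u w : matching A M -> e \in M -> joins e u w ->
  [/\ u != w, u \in A & w \in A].
Proof.
move=> /matchingP MM eM euw; have Hu := leq_trans (inc_le_sdeg u eM) (MM u).
have Hw := leq_trans (inc_le_sdeg w eM) (MM w).
rewrite !(joins_inc _ euw) !eqxx in Hu Hw.
move: Hu Hw; rewrite (eq_sym w u); case: (u == w) (u \in A) (w \in A) => [] [] [] //.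
Qed.

Lemma matching_unique A M e f v : matching A M -> e \in M -> f \in M ->
  0 < inc e v -> 0 < inc f v -> e = f.
Proof.
move=> /matchingP MM eM fM ev fv; apply/eqP; apply: contraT => ef.
have := MM v; rewrite (sdegD1 v eM) (@sdegD1 f) ?inE; last by rewrite eq_sym ef.
by lia.
Qed.

Lemma card_matching A M : matching A M ->
  #|[set v in A | sdeg M v == 0]| + #|M|.*2 = #|A|.
Proof.
move=> MM; have -> : #|M|.*2 = \sum_(v in A) sdeg M v.
  rewrite sum_sdeg -mul2n mulnC -sum_nat_const; apply: eq_bigr => e eM.
  by have [_ e1 e2] := matching_joins MM eM (joins_ends e); rewrite /nends e1 e2.
rewrite -sum1_card -[RHS]sum1_card (eq_bigl (fun v => (v \in A) && (sdeg M v == 0)));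
  last by move=> v; rewrite inE.
rewrite big_mkcondr -big_split /=; apply: eq_bigr => v vA.
by move/matchingP/(_ v): MM; rewrite vA; case: (sdeg M v) => [|[|]].
Qed.

Lemma matching_addE A M e u w : max_matching A M -> u \in A -> w \in A -> u != w ->
  joins e u w -> sdeg M u = 0 -> sdeg M w = 0 -> False.
Proof.
move=> /max_matchingP[MM Mmax] uA wA uw euw Mu Mw.
have eM : e \notin M.
  by apply/negP => /(@inc_le_sdeg _ _ u); rewrite Mu (joins_inc _ euw) eqxx.
suff /Mmax : matching A (e |: M) by rewrite cardsU1 eM; lia.
apply/matchingP => v; rewrite sdegU1 // (joins_inc _ euw).
move/matchingP/(_ v): MM; case: (eqVneq u v) uw => [<-|_ _].
  by rewrite eq_sym => /negPf->; rewrite Mu uA.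
by case: (eqVneq w v) => [<-|]; rewrite ?Mw ?wA.
Qed.

(** Gallai's relation. Reflexivity is put in by hand, since a maximum matching may well miss a
    single vertex. *)
Definition never_both A u v : bool := (u == v) ||
  [forall M : {set E}, max_matching A M ==> ((0 < sdeg M u) || (0 < sdeg M v))].

Lemma never_bothP A u v M : never_both A u v -> u != v -> max_matching A M ->
  sdeg M u = 0 -> 0 < sdeg M v.
Proof.
by move=> /orP[->//|/forallP/(_ M)/implyP H] _ /H /orP[]// => [+ Mu]; rewrite Mu.
Qed.

Lemma never_both_sym A : symmetric (never_both A).
Proof.
by move=> u v; rewrite /never_both eq_sym; congr orb; apply: eq_forallb => M; rewrite orbC.
Qed.

(* Gallai's exchange: [N] avoids [t] and agrees with [M] as much as possible. *)
Lemma never_both_trans A t u v : t \in A -> u \in A -> v \in A ->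
  (exists2 M, max_matching A M & sdeg M t = 0) ->
  never_both A u t -> never_both A t v -> never_both A u v.
Proof.
move=> tA uA vA [N0 N0max N0t] ut tv; have [->//|neuv] := eqVneq u v.
  by rewrite /never_both eqxx.
have [eut|neut] := eqVneq u t; first by rewrite eut.
have [etv|netv] := eqVneq t v; first by rewrite -etv.
apply/orP; right; apply/forallP => M; apply/implyP => Mmax.
apply: contraT; rewrite negb_or -!leqNgt !leqn0 => /andP[/eqP Mu /eqP Mv].
have Mt : 0 < sdeg M t by apply: (never_bothP ut) Mu.
have P0 : max_matching A N0 && (sdeg N0 t == 0) by rewrite N0max N0t.
case: (@arg_maxnP _ N0 (fun N => max_matching A N && (sdeg N t == 0)) (fun N => #|M :&: N|) P0)
  => N /andP[Nmax /eqP Nt] Nbest.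
have Nu : 0 < sdeg N u by apply: (never_bothP _ _ Nmax Nt); rewrite 1?eq_sym // never_both_sym.
have Nv : 0 < sdeg N v by apply: (never_bothP tv).
have /max_matchingP[MM ML] := Mmax; have /max_matchingP[NM NL] := Nmax.
have cardMN : #|M| = #|N| by apply/eqP; rewrite eqn_leq ML // NL.
have [x [xt xA Nx Mx]] : exists x, [/\ x != t, x \in A, sdeg N x = 0 & 0 < sdeg M x].
  pose mM := [set z in A | sdeg M z == 0]; pose mN := [set z in A | sdeg N z == 0].
  have cmm : #|mM| = #|mN|.
    have cM : #|mM| + #|M|.*2 = #|A| := card_matching MM.
    have cN : #|mN| + #|N|.*2 = #|A| := card_matching NM.
    by move: cM cN; rewrite cardMN => <- /addIn.
  (* [M] and [N] miss equally many vertices, and [u], [v] are missed by [M] only; so [N] alone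
     misses at least two, one of them other than [t]. *)
  have : 2 <= #|mN :\: mM|.
    have -> : #|mN :\: mM| = #|mM :\: mN|.
      by rewrite !cardsD cmm setIC.
    have -> : 2 = #|[set u; v]| by rewrite cards2 neuv.
    apply: subset_leq_card; apply/subsetP => z; rewrite !inE => /orP[]/eqP->.
      by rewrite uA Mu /= -lt0n Nu.
    by rewrite vA Mv /= -lt0n Nv.
  move=> c2; have : 0 < #|(mN :\: mM) :\ t|.
    by rewrite -ltnS (leq_trans c2) // (cardsD1 t) -[_.+1]add1n leq_add2r leq_b1.
  rewrite card_gt0 => /set0Pn[x]; rewrite !inE => /and3P[xt xM /andP[xA /eqP Nx]].
  by exists x; split=> //; move: xM; rewrite xA lt0n.
have /sdeg_gt0P[e eM /inc_gt0P[y exy]] := Mx.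
have [xy _ yA] := matching_joins MM eM exy.
have Ny : 0 < sdeg N y.
  by rewrite lt0n; apply/eqP => Ny; apply: (matching_addE Nmax xA yA xy exy).
have /sdeg_gt0P[f fN fy] := Ny.
have eN : e \notin N by apply/negP => /(@inc_le_sdeg _ _ x); rewrite Nx (joins_inc _ exy) eqxx.
have ey : 0 < inc e y by rewrite (joins_inc _ exy) eqxx addnC.
have fM : f \notin M.
  by apply/negP => fM; rewrite (matching_unique MM eM fM ey fy) fN in eN.
(* Trading [f] for [e] gives another maximum matching that misses [t] but shares one more edge with
   [M]. *)
have [N' [dN' cN' MN']] : exists N', [/\ forall z, sdeg N' z + inc f z = inc e z + sdeg N z,
    #|N'| = #|N| & M :&: N' = e |: (M :&: N)].
  have eNf : e \notin N :\ f by rewrite !inE (negPf eN) andbF.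
  exists (e |: (N :\ f)); split=> [z||].
  - by rewrite sdegU1 // (sdegD1 z fN) -addnA; congr addn; apply: addnC.
  - by rewrite cardsU1 eNf (cardsD1 f N) fN.
  apply/setP => g; rewrite !inE; case: (eqVneq g e) => [->|_] /=; first by rewrite eM.
  by case: (eqVneq g f) => [->|]; rewrite //= (negPf fM).
have N'M : matching A N'.
  apply/matchingP => z; have := dN' z; rewrite (joins_inc _ exy).
  move/matchingP/(_ z): NM; case: (eqVneq x z) => [<-|_].
    by rewrite Nx xA eq_sym (negPf xy) /=; move: (inc f x); nlia.
  case: (eqVneq y z) => [<-|_].
    by rewrite yA; move: fy; move: (inc f y); nlia.
  by move: (inc f z); nlia.
have N't : sdeg N' t = 0.
  have := dN' t; rewrite (joins_inc _ exy) Nt (negPf xt).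
  by case: (eqVneq y t) => [yt|_]; [rewrite yt Nt in Ny | move: (inc f t); nlia].
have N'max : max_matching A N' by apply/max_matchingP; split=> // L; rewrite cN'; apply: NL.
have := Nbest N'; rewrite N'max N't => /(_ isT).
by rewrite MN' cardsU1 inE (negPf eN) andbF add1n /geq /= ltnn.
Qed.

(** Closure under adjacency stands in for connectivity: the members of [P] are disjoint odd unions
    of components of the graph induced on [A :\: S]. *)
Definition barrier A S (P : {set {set V}}) : Prop :=
  [/\ S \subset A, trivIset P &
      forall K, K \in P -> [/\ K \subset A :\: S, odd #|K| &
        forall e u w, joins e u w -> u \in K -> w \in A -> w \in K :|: S]].

(** This inequality is the hard half of the formula. If some vertex lies in every maximum matching,
    it is deleted and later added to [S]. Otherwise [never_both] is an equivalence relation and [S]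
    is empty: adjacent vertices are related, so classes are closed, and a maximum matching misses at
    most one vertex per class. *)
Lemma tutte_berge A : exists S P M,
  [/\ barrier A S P, matching A M & #|A| + #|S| <= #|P| + #|M|.*2].
Proof.
have [n] := ubnP #|A|; elim: n A => // n IH A; rewrite ltnS => An.
have [L Lmax] := max_matching_exists A; have /max_matchingP[LM LL] := Lmax.
have [/exists_inP[v vA /forallP vess]|/exists_inPn noess] :=
  boolP [exists v in A, [forall M : {set E}, max_matching A M ==> (0 < sdeg M v)]].
  have Av : #|A :\ v| < n by rewrite (cardsD1 v A) vA in An.
  have [S [P [M [[SA tP PK] MM def]]]] := IH _ Av.
  have vS : v \notin S by apply/negP => /(subsetP SA); rewrite !inE eqxx.
  exists (v |: S), P, L; split=> //.
    split=> // [|K KP].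
      by apply/subsetP => u; rewrite !inE => /orP[/eqP->//|/(subsetP SA)]; rewrite !inE => /andP[].
    have [KA oK clK] := PK K KP; split=> //.
      by apply/subsetP => u /(subsetP KA); rewrite !inE negb_or => /and3P[-> -> ->].
    move=> e u w euw uK wA; have [->|wv] := eqVneq w v; first by rewrite !inE eqxx orbT.
    have : w \in K :|: S by apply: (clK e u w) => //; rewrite !inE wv.
    by rewrite !inE => /orP[] ->; rewrite ?orbT.
  (* [M] misses [v], which every maximum matching covers. The gained edge counts twice, which pays
     for [v] in both [A] and [S]. *)
  have ltML : #|M| < #|L|.
    have MA : matching A M.
      apply/matchingP => u; move/matchingP/(_ u): MM; rewrite !inE => /leq_trans; apply.
      by case: (u != v).
    rewrite ltnNge; apply/negP => LeM.
    have Mmax : max_matching A M.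
      by apply/max_matchingP; split=> // N /LL /leq_trans; apply.
    have := vess M; rewrite Mmax /=.
    by move/matchingP/(_ v): MM; rewrite !inE eqxx; case: (sdeg M v).
  by rewrite cardsU1 vS (cardsD1 v A) vA; move: def ltML; nlia.
have {}noess v : v \in A -> exists2 M, max_matching A M & sdeg M v = 0.
  move/noess/forallPn => [M]; rewrite negb_imply -leqNgt leqn0 => /andP[? /eqP ?].
  by exists M.
have eqR : {in A & &, equivalence_rel (never_both A)}.
  move=> x y z xA yA zA; split; first by rewrite /never_both eqxx.
  move=> xy; apply/idP/idP => H; last exact: (never_both_trans yA xA zA (noess _ yA) xy).
  by apply: (never_both_trans xA yA zA (noess _ xA)) H; rewrite never_both_sym.
pose P := equivalence_partition (never_both A) A.
have /and3P[/eqP covP tP P0] : partition P A by apply: equivalence_partitionP.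
have PE K u w : K \in P -> u \in K -> (w \in K) = (w \in A) && never_both A u w.
  move=> KP uK; have uA : u \in A by rewrite -covP; apply/bigcupP; exists K.
  apply/idP/andP => [wK|[wA]].
    have wA : w \in A by rewrite -covP; apply/bigcupP; exists K.
    by rewrite -(pblock_equivalence_partition eqR uA wA) (def_pblock tP KP uK).
  by rewrite -(pblock_equivalence_partition eqR uA wA) (def_pblock tP KP uK).
have adj e u w : joins e u w -> u \in A -> w \in A -> never_both A u w.
  move=> euw uA wA; have [->|uw] := eqVneq u w; first by rewrite /never_both eqxx.
  apply/orP; right; apply/forallP => M; apply/implyP => Mmax.
  apply: contraT; rewrite negb_or -!leqNgt !leqn0 => /andP[/eqP Mu /eqP Mw].
  by case: (matching_addE Mmax uA wA uw euw Mu Mw).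
exists set0, P, L; split=> //; last first.
  rewrite cards0 addn0 -(card_matching LM) leq_add2r.
  rewrite -(card_in_imset (f := pblock P) (D := [set v in A | sdeg L v == 0])).
    apply: subset_leq_card; apply/subsetP => B /imsetP[v]; rewrite inE => /andP[vA _] ->.
    by rewrite pblock_mem // covP.
  move=> x y; rewrite !inE => /andP[xA /eqP Lx] /andP[yA /eqP Ly] /eqP.
  rewrite eq_pblock ?covP // (pblock_equivalence_partition eqR) // => Rxy.
  by apply/eqP; apply: contraT => xy; have := never_bothP Rxy xy Lmax Lx; rewrite Ly.
split=> //; first exact: sub0set.
move=> K KP; have KA : K \subset A by rewrite -covP; apply: bigcup_sup.
split=> [||e u w euw uK wA]; first by rewrite setD0.
  have /set0Pn[v vK] : K != set0 by apply: contraNneq P0 => <-.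
  have vA := subsetP KA v vK; have [M Mmax Mv] := noess v vA.
  have /max_matchingP[MM _] := Mmax.
  (* No edge of [M] leaves the class [K], so the sum is even; as [M] misses only [v] in [K], it
     equals [#|K| - 1]. *)
  have: ~~ odd (\sum_(u in K) sdeg M u).
    rewrite odd_sum_sdeg; suff -> : M :&: cut K = set0 by rewrite cards0.
    apply/setP => e; rewrite !inE; apply/negP => /andP[eM].
    have [_ e1 e2] := matching_joins MM eM (joins_ends e).
    have Re := adj _ _ _ (joins_ends e) e1 e2.
    have [e1K|e1K] := boolP (_ \in K); first by rewrite (PE _ _ _ KP e1K) e2 Re.
    case: (boolP (_ \in K)) => // e2K _.
    by rewrite (PE _ _ _ KP e2K) e1 never_both_sym Re in e1K.
  rewrite (bigD1 v) //= Mv (cardsD1 v K) vK add0n.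
  suff -> : \sum_(u in K | u != v) sdeg M u = #|K :\ v| by rewrite oddD => /negPf->.
  rewrite -sum1_card; apply: eq_big => [u|u /andP[uK uv]]; first by rewrite !inE andbC.
  move: (uK); rewrite (PE _ _ _ KP vK) => /andP[uA Rvu].
  have := never_bothP Rvu _ Mmax Mv; rewrite eq_sym uv => /(_ isT).
  by move/matchingP/(_ u): MM; rewrite uA; case: (sdeg M u) => [|[|]].
by rewrite setU0 (PE _ _ _ KP uK) wA (adj _ _ _ euw) // (subsetP KA).
Qed.

(** * Odd cuts and barriers in bridgeless cubic graphs *)

Definition odd_3cut X : bool := odd #|X| && (#|cut X| == 3).

Lemma card_cut X : #|cut X| = \sum_(e : E) (e \in cut X).
Proof.
by rewrite -sum1_card big_mkcond; apply: eq_bigr => e _; case: (_ \in _).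
Qed.

Section BridgelessCubic.
Hypotheses (cubicG : cubic ends) (bridgelessG : bridgeless ends).

Lemma odd_card_cut X : odd #|cut X| = odd #|X|.
Proof.
rewrite -[cut X]setTI -odd_sum_sdeg (eq_bigr (fun=> 3)) => [|v _]; last exact: cubicG.
by rewrite sum_nat_const oddM andbT.
Qed.

Lemma odd_cut_perfect_matching M X : perfect_matching ends M -> odd #|M :&: cut X| = odd #|X|.
Proof.
by move=> PM; rewrite -odd_sum_sdeg (eq_bigr (fun=> 1)) ?sum1_card // => v _; apply: PM.
Qed.

(** The cut has odd size, and a cut with a single edge would make that edge a bridge. *)
Lemma odd_cut_ge3 X : odd #|X| -> 3 <= #|cut X|.
Proof.
move=> oX; have: odd #|cut X| by rewrite odd_card_cut.
case E1: #|cut X| => [|[|[|]]] // _; have /eqP/cards1P[e cutX] := E1.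
have := bridgelessG e; rewrite negbK => conn.
have : e \in cut X by rewrite cutX set11.
rewrite inE (@closed_connect _ (adj_without ends e) (mem X) _ _ _ conn) ?eqxx // => x y.
move=> /existsP[f /andP[fe fxy]]; apply/eqP; apply: contraNT fe.
by rewrite -in_set1 -cutX (@joins_cut f x y).
Qed.

(** A loop at [u] would use up two of its three edge ends and leave at most one edge in the cut of
    the odd set [[set u]]. *)
Lemma cubic_loopless e u w : joins e u w -> u != w.
Proof.
move=> euw; apply/eqP => eq_uw; rewrite -{w}eq_uw in euw.
have c3 : 3 <= #|cut [set u]| by rewrite odd_cut_ge3 ?cards1.
have := cubicG u; rewrite sdegE (bigD1 e) //= (joins_inc _ euw) eqxx.
have : #|cut [set u]| <= \sum_(f in setT | f != e) inc f u; last by lia.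
have ecut : e \notin cut [set u] by rewrite (joins_cut _ euw) eqxx.
rewrite -sum1_card big_mkcond [X in _ <= X]big_mkcond; apply: leq_sum => f _.
case: ifP => // fcut; rewrite !inE; case: eqP => [fe|_]; first by rewrite -fe fcut in ecut.
by move: fcut; rewrite !inE /inc; do 2!case: (_ == u).
Qed.

Lemma odd_card_vertices : odd #|V| = false.
Proof.
rewrite -cardsT -odd_card_cut; suff -> : cut [set: V] = set0 by rewrite cards0.
by apply/setP => e; rewrite !inE.
Qed.

(** [D] is a prescribed matching with vertex set [U], to be completed off [U]. Since [#|V|] and
    [#|U|] are even, so is the number of missed vertices; a failure therefore misses at least 2, the
    constant in [#|S| + 2]. *)
Lemma perfect_matching_or_barrier (D : {set E}) (U : {set V}) :
  (forall v, sdeg D v = (v \in U)) -> ~~ odd #|U| ->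
  (exists2 M, perfect_matching ends M & D \subset M) \/
  (exists S P, barrier (~: U) S P /\ #|S| + 2 <= #|P|).
Proof.
move=> DU oU; have [S [P [M [barr MM def]]]] := tutte_berge (~: U).
have cM := card_matching MM; have oA : ~~ odd #|~: U|.
  by have := cardsC U; have := odd_card_vertices; move: oU; lia.
case: (posnP #|[set v in ~: U | sdeg M v == 0]|) => [/cards0_eq miss0|miss_gt0]; last first.
  by right; exists S, P; split=> //; lia.
left; exists (D :|: M); last exact: subsetUl.
have Mdeg v : sdeg M v = (v \notin U).
  move/matchingP/(_ v): MM; move/setP/(_ v): miss0; rewrite !inE.
  by case: (v \in U) => /=; case: (sdeg M v) => [|[|]].
move=> v; rewrite sdegU; first by rewrite DU Mdeg; case: (v \in U).
apply/pred0P => e /=; apply/negP => /andP[eD eM].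
have := inc_le_sdeg (ends e).1 eD; have := inc_le_sdeg (ends e).1 eM.
by rewrite DU Mdeg (joins_inc _ (joins_ends e)) eqxx; case: (_ \in U).
Qed.

(** * Counting edge ends around a barrier *)

Section Barrier.
Variables (U S : {set V}) (P : {set {set V}}).
Hypothesis barr : barrier (~: U) S P.

Let T := S :|: U.
Let crossings e := \sum_(K in P) (e \in cut K).

Lemma barrier_cut K e u w : K \in P -> joins e u w -> u \in K -> w \notin K -> w \in T.
Proof.
move=> KP euw uK wK; have [_ _ /(_ K KP)[_ _ clK]] := barr.
have [wU|wU] := boolP (w \in U); first by rewrite inE wU orbT.
by have := clK e u w euw uK; rewrite !inE wU (negPf wK) => /(_ isT) /= ->.
Qed.

Lemma barrier_disjoint K u : K \in P -> u \in K -> u \notin T.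
Proof.
move=> KP uK; have [_ _ /(_ K KP)[/subsetP/(_ u uK) + _ _]] := barr.
by rewrite !inE negb_or.
Qed.

(** An edge leaving a member of [P] has its outer end in [T], and the member holding its inner end
    is unique by disjointness. *)
Lemma crossings_le e : crossings e <= nends e T.
Proof.
have aux a b : joins e a b -> a \in T -> crossings e <= nends e T.
  move=> eab aT; rewrite (joins_nends _ eab) aT.
  case: (boolP [exists K in P, e \in cut K]) => [/exists_inP[K KP eK]|/exists_inPn noK]; last first.
    by rewrite /crossings big1 // => K /noK/negPf->.
  have inK L : L \in P -> e \in cut L -> b \in L.
    move=> LP; rewrite (joins_cut _ eab); case: (boolP (a \in L)) => [aL|_].
      by have := barrier_disjoint LP aL; rewrite aT.
    by case: (b \in L).
  rewrite /crossings (bigD1 K) //= eK big1 // => L /andP[LP LK].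
  apply/eqP; rewrite eqb0; apply: contra LK => eL; have [_ tP _] := barr.
  by rewrite -(def_pblock tP LP (inK L LP eL)) (def_pblock tP KP (inK K KP eK)).
have [aT|aT] := boolP ((ends e).1 \in T); first exact: aux (joins_ends e) aT.
have [bT|bT] := boolP ((ends e).2 \in T); first by apply: (aux _ (ends e).1) bT; rewrite joinsC joins_ends.
rewrite /crossings big1 // => K KP; apply/eqP; rewrite eqb0; apply/negP.
have [aK|aK] := boolP ((ends e).1 \in K).
  by rewrite inE aK; case: (boolP (_ \in K)) => // bK; rewrite (barrier_cut KP (joins_ends e) aK bK) in bT.
rewrite inE (negPf aK); case: (boolP (_ \in K)) => // bK; have := joins_ends e; rewrite joinsC => ee.
by rewrite (barrier_cut KP ee bK aK) in aT.
Qed.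

Lemma sum_crossings : \sum_(e : E) crossings e = \sum_(K in P) #|cut K|.
Proof. by rewrite exchange_big; apply: eq_bigr => K _; rewrite card_cut. Qed.

(** Edge ends in [T] are counted twice over. The two sums keep the slack, namely cut edges beyond
    the third and ends in [T] not spent on a crossing, so that both vanish when the bound is tight.
    Neither subtraction truncates. *)
Lemma barrier_count : 3 * #|P| + \sum_(K in P) (#|cut K| - 3) +
  \sum_(e : E) (nends e T - crossings e) <= 3 * (#|S| + #|U|).
Proof.
have -> : 3 * #|P| + \sum_(K in P) (#|cut K| - 3) = \sum_(K in P) #|cut K|.
  rewrite mulnC -sum_nat_const -big_split /=; apply: eq_bigr => K KP.
  by rewrite subnKC // odd_cut_ge3 //; have [_ _ /(_ K KP)[]] := barr.
rewrite -sum_crossings -big_split /= (eq_bigr (nends^~ T)) => [|e _]; last first.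
  by rewrite subnKC ?crossings_le.
have <- : \sum_(v in T) sdeg setT v = \sum_(e : E) nends e T.
  by rewrite sum_sdeg; apply: eq_bigl => e; rewrite inE.
rewrite (eq_bigr (fun=> 3)) => [|v _]; last exact: cubicG.
by rewrite sum_nat_const mulnC leq_pmul2l // cardsU leq_subr.
Qed.

Lemma crossings_inner e u w : joins e u w -> u \in T -> w \in T -> crossings e = 0.
Proof.
move=> euw uT wT; rewrite /crossings big1 // => K KP; apply/eqP; rewrite eqb0 (joins_cut _ euw).
case: (boolP (u \in K)) => [/(barrier_disjoint KP)|_]; first by rewrite uT.
by case: (boolP (w \in K)) => // /(barrier_disjoint KP); rewrite wT.
Qed.

Lemma slack_inner e u w : joins e u w -> u \in U -> w \in U -> nends e T - crossings e = 2.
Proof.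
move=> euw uU wU; have uT : u \in T by rewrite inE uU orbT.
have wT : w \in T by rewrite inE wU orbT.
by rewrite (crossings_inner euw) // (joins_nends _ euw) uT wT.
Qed.

End Barrier.

(** A barrier would need [3 * (#|S| + 2)] ends for its cuts and 2 more wasted on [e] itself, but
    only [3 * (#|S| + 2)] are available. *)
Lemma edge_in_perfect_matching e : exists2 M, perfect_matching ends M & e \in M.
Proof.
have ee := joins_ends e; move: (_.1) (_.2) ee => u w euw.
have uw := cubic_loopless euw.
case: (@perfect_matching_or_barrier [set e] [set u; w]) => [v|||].
- rewrite sdeg1 (joins_inc _ euw) !inE !(eq_sym v).
  by case: (eqVneq u v) uw => [<-|//]; rewrite eq_sym; case: eqP.
- by rewrite cards2 uw.
- by case=> M PM; rewrite sub1set; exists M.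
move=> [S [P [barr leP]]]; exfalso.
move: leP (barrier_count barr); move: #|P| => p leP.
rewrite (bigD1 e) //= (slack_inner barr euw) ?inE ?eqxx ?orbT // cards2 uw; move: leP; nlia.
Qed.

Lemma odd_cut_of_unmatchable_path a b c d d' d'' v0 v1 v2 v3 v4 v5 :
  joins a v0 v1 -> joins d v1 v2 -> joins b v2 v3 ->
  joins d' v3 v4 -> joins c v4 v5 -> joins d'' v5 v0 ->
  uniq [:: v0; v1; v2; v3; v4; v5] ->
  (exists M, [/\ perfect_matching ends M, a \in M & b \in M]) \/
  (exists X, [/\ odd_3cut X, v4 \in X, v5 \in X & [/\ v0 \notin X, v1 \notin X, v2 \notin X & v3 \notin X]]).
Proof.
move=> ja jd jb jd' jc jd''; rewrite /= !inE !negb_or !andbT.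
move=> /and5P[/and5P[n01 n02 n03 n04 n05] /and4P[n12 n13 n14 n15] /and3P[n23 n24 n25] /andP[n34 n35] n45].
pose U := [set v0; v1; v2; v3].
have neq_joins e f x y z t : joins e x y -> joins f z t -> x != z -> x != t -> e != f.
  move=> je jf xz xt; apply/eqP => ef; move: (joins_inc x je); rewrite ef (joins_inc x jf).
  by rewrite !(eq_sym _ x) eqxx (negPf xz) (negPf xt).
have ab : a != b by apply: neq_joins ja jb _ _.
have ad : a != d by apply: neq_joins ja jd _ _.
have db : d != b by apply: neq_joins jd jb _ _.
have cardU : #|U| = 4.
  have /card_uniqP/= <- : uniq [:: v0; v1; v2; v3] by rewrite /= !inE !negb_or n01 n02 n03 n12 n13 n23.
  by apply: eq_card => v; rewrite !inE -!orbA.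
case: (@perfect_matching_or_barrier [set a; b] U) => [v|||].
- rewrite sdegU1 1?inE // sdeg1 (joins_inc _ ja) (joins_inc _ jb) !inE !(eq_sym v).
  case: (eqVneq v0 v) => [<-|_]; first by rewrite !(eq_sym _ v0) (negPf n01) (negPf n02) (negPf n03).
  case: (eqVneq v1 v) => [<-|_]; first by rewrite !(eq_sym _ v1) (negPf n12) (negPf n13).
  by case: (eqVneq v2 v) => [<-|_]; first by rewrite !(eq_sym _ v2) (negPf n23).
- by rewrite cardU.
- by case=> M PM /subsetP sub; left; exists M; split=> //; apply: sub; rewrite !inE eqxx ?orbT.
move=> [S [P [barr leP]]]; right.
move: leP (barrier_count barr); move: #|P| => p leP.
have [_ tP PK] := barr.
have inU v : v \in [:: v0; v1; v2; v3] -> v \in U by rewrite !inE -!orbA.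
have u0 : v0 \in U by rewrite !inE eqxx.
have u1 : v1 \in U by rewrite !inE eqxx orbT.
have u2 : v2 \in U by rewrite !inE eqxx orbT.
have u3 : v3 \in U by rewrite !inE eqxx orbT.
rewrite (bigD1 a) //= (bigD1 d) 1?eq_sym //= (bigD1 b) /=; last by rewrite !(eq_sym b) ab db.
rewrite (slack_inner barr ja) // (slack_inner barr jd) // (slack_inner barr jb) // cardU.
set Z1 := (X in _ + X + _ <= _); set Z2 := (X in _ + (2 + (2 + (2 + X))) <= _) => count.
(* The cuts take at least [3 * #|S| + 6] ends and the path edges [a], [d], [b] take 6, which
   exhausts [3 * (#|S| + 4)]. *)
have [/eqP/[!sum_nat_eq0]/forall_inP cut3 /eqP/[!sum_nat_eq0]/forall_inP tight] : Z1 = 0 /\ Z2 = 0.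
  by move: leP count; move: Z1 Z2; nlia.
have in_comp e u w : joins e u w -> e != a -> e != d -> e != b -> u \in U -> exists2 K, K \in P & w \in K.
  move=> euw ea ed eb uU; have uT : u \in S :|: U by rewrite inE uU orbT.
  have := tight e; rewrite ea ed eb => /(_ isT).
  case: (boolP [exists K in P, e \in cut K]) => [/exists_inP[K KP]|/exists_inPn noK].
    rewrite (joins_cut _ euw); case: (boolP (u \in K)) => [/(barrier_disjoint barr KP)|_].
      by rewrite uT.
    by case: (boolP (w \in K)) => // wK _; exists K.
  rewrite big1 => [|K /noK/negPf->//].
  by rewrite (joins_nends _ euw) uT.
have [K KP v5K] : exists2 K, K \in P & v5 \in K.
  by apply: (in_comp d'' v0); rewrite 1?joinsC //; apply: neq_joins jd'' _ _ _; eassumption || rewrite eq_sym.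
have [K' K'P v4K'] : exists2 K, K \in P & v4 \in K.
  apply: (in_comp d' v3) => //.
  - by apply: neq_joins jd' ja _ _; rewrite eq_sym.
  - by apply: neq_joins jd' jd _ _; rewrite eq_sym.
  by rewrite joinsC in jd'; apply: neq_joins jd' jb _ _; rewrite eq_sym.
have [KA oK clK] := PK K KP; have dis := barrier_disjoint barr KP.
have out v : v \in U -> v \notin K by move=> vU; apply/negP => /dis; rewrite inE vU orbT.
exists K; split=> //; last by split; apply: out.
  by rewrite /odd_3cut oK eqn_leq odd_cut_ge3 // andbT -subn_eq0 cut3.
(* The edge [c] leads from [v5] in [K] to [v4], which lies in a member of [P] and hence outside [S];
   so [v4] is in [K] as well. *)
have : v4 \in K :|: S.
  apply: (clK c v5) => //; first by rewrite joinsC.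
  by rewrite !inE !(eq_sym v4) !negb_or n04 n14 n24 n34.
have := barrier_disjoint barr K'P v4K'; rewrite !inE negb_or => /andP[/negPf-> _].
by rewrite orbF.
Qed.

(** The edge [e] is in both cuts but in neither that of the intersection nor that of the union, so
    submodularity leaves these two at most 4 edges together. Were the intersection odd, they would
    need 6. So both differences are odd, and posimodularity bounds their cuts by 6 in total, that is
    3 each. *)
Lemma odd_3cut_uncross X Y e u w : odd_3cut X -> odd_3cut Y -> joins e u w ->
  u \in X :\: Y -> w \in Y :\: X -> odd_3cut (X :\: Y).
Proof.
move=> /andP[oX /eqP cX] /andP[oY /eqP cY] euw; rewrite !inE => /andP[uY uX] /andP[wX wY].
have submod : #|cut (X :&: Y)| + #|cut (X :|: Y)| + 2 <= 6.
  have <- : #|cut X| + #|cut Y| = 6 by rewrite cX cY.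
  rewrite !card_cut -!big_split /= (bigD1 e) //= [X in _ <= X](bigD1 e) //=.
  rewrite !(joins_cut _ euw) !inE (negPf uY) uX (negPf wX) wY /= addnC leq_add2l.
  apply: leq_sum => f _; rewrite !inE.
  by do 2!case: (_ \in X); do 2!case: (_ \in Y).
have posmod : #|cut (X :\: Y)| + #|cut (Y :\: X)| <= 6.
  have <- : #|cut X| + #|cut Y| = 6 by rewrite cX cY.
  rewrite !card_cut -!big_split /=.
  apply: leq_sum => f _; rewrite !inE.
  by do 2!case: (_ \in X); do 2!case: (_ \in Y).
have eXY : ~~ odd #|X :&: Y|.
  apply/negP => oI; have oU : odd #|X :|: Y|.
    have := congr1 odd (cardsUI X Y); rewrite !oddD oI oX oY.
    by case: (odd _).
  by have := odd_cut_ge3 oI; have := odd_cut_ge3 oU; move: submod; nlia.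
have oD : odd #|X :\: Y| by have := congr1 odd (cardsID Y X); rewrite oddD (negPf eXY) oX.
have oD' : odd #|Y :\: X|.
  by have := congr1 odd (cardsID X Y); rewrite setIC oddD (negPf eXY) oY.
rewrite /odd_3cut oD /=.
by have := odd_cut_ge3 oD; have := odd_cut_ge3 oD'; move: posmod; nlia.
Qed.

(** * Ears of a hexagon *)

(** The pairs of matchings are placed so that turning the hexagon by two vertices shifts [M1], [M2],
    [M3] cyclically; each later statement is proved in one position and carried over by
    [hexagon_rot]. *)
Record hexagon M1 M2 M3 v0 v1 v2 v3 v4 v5 e01 e12 e23 e34 e45 e50 : Prop := Hexagon {
  hex_matching : [/\ perfect_matching ends M1, perfect_matching ends M2 & perfect_matching ends M3];
  hex_uniq : uniq [:: v0; v1; v2; v3; v4; v5];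
  hex01 : joins e01 v0 v1;
  hex12 : joins e12 v1 v2;
  hex23 : joins e23 v2 v3;
  hex34 : joins e34 v3 v4;
  hex45 : joins e45 v4 v5;
  hex50 : joins e50 v5 v0;
  hex12_in : [/\ e12 \in M1, e12 \in M2 & e12 \notin M3];
  hex34_in : [/\ e34 \in M2, e34 \in M3 & e34 \notin M1];
  hex50_in : [/\ e50 \in M3, e50 \in M1 & e50 \notin M2];
  hex_uncovered : ~: (M1 :|: M2 :|: M3) = [set e01; e23; e45]
}.

Lemma hexagon_rot M1 M2 M3 v0 v1 v2 v3 v4 v5 e01 e12 e23 e34 e45 e50 :
  hexagon M1 M2 M3 v0 v1 v2 v3 v4 v5 e01 e12 e23 e34 e45 e50 ->
  hexagon M2 M3 M1 v2 v3 v4 v5 v0 v1 e23 e34 e45 e50 e01 e12.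
Proof.
move=> H; split; try by case: H.
- by case: H => -[].
- by have := hex_uniq H; rewrite -(rot_uniq 2).
rewrite setUC setUA (hex_uncovered H).
by apply/setP => e; rewrite !inE -!orbA orbC -!orbA.
Qed.

Definition ear v0 v1 v2 v3 v4 v5 X : bool :=
  [&& odd_3cut X, v4 \in X, v5 \in X, v0 \notin X, v1 \notin X, v2 \notin X & v3 \notin X].

Definition minimal_ear v0 v1 v2 v3 v4 v5 X : Prop :=
  ear v0 v1 v2 v3 v4 v5 X /\ forall Y, ear v0 v1 v2 v3 v4 v5 Y -> #|X| <= #|Y|.

Lemma minimal_ear_exists v0 v1 v2 v3 v4 v5 X :
  ear v0 v1 v2 v3 v4 v5 X -> exists Y, minimal_ear v0 v1 v2 v3 v4 v5 Y.
Proof. by case/(@arg_minnP _ X (ear v0 v1 v2 v3 v4 v5) (fun Y => #|Y|)) => Y; exists Y. Qed.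

(** The hexagon edge from [v5] to [v0] allows uncrossing, and [X :\: Y] still contains [v4] and
    [v5]: it is an ear, so by minimality nothing was removed. *)
Lemma minimal_ear_disjoint v0 v1 v2 v3 v4 v5 e X Y : joins e v5 v0 ->
  minimal_ear v0 v1 v2 v3 v4 v5 X -> ear v2 v3 v4 v5 v0 v1 Y -> [disjoint X & Y].
Proof.
move=> e50 [/and5P[cX x4 x5 x0 /and3P[x1 x2 x3]] minX].
move=> /and5P[cY y0 y1 y2 /and3P[y3 y4 y5]].
have cD : odd_3cut (X :\: Y).
  by apply: (odd_3cut_uncross cX cY e50); rewrite inE ?x5 ?y5 ?x0 ?y0.
have /minX : ear v0 v1 v2 v3 v4 v5 (X :\: Y).
  by rewrite /ear cD !inE x4 x5 y4 y5 (negPf x0) (negPf x1) (negPf x2) (negPf x3) !andbF.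
by rewrite -(cardsID Y X) -setI_eq0 -cards_eq0; nlia.
Qed.

(** A perfect matching meets an odd cut in an odd number of edges. [C] already has two of the three
    and must take [f]; [A] and [B] have one each and must not. *)
Lemma third_cut_edge (A B C : {set E}) X (p q f : E) :
  perfect_matching ends A -> perfect_matching ends B -> perfect_matching ends C ->
  odd_3cut X -> p \in cut X -> q \in cut X -> f \in cut X ->
  [/\ p \in C, p \in A & p \notin B] -> [/\ q \in B, q \in C & q \notin A] -> f != p -> f != q ->
  [/\ f \notin A, f \notin B & f \in C].
Proof.
move=> PA PB PC /andP[oX /eqP cX] pX qX fX [pC pA pB] [qB qC qA] fp fq.
have qp : q != p by apply: contraNneq qA => ->.
have uniq_pqf : uniq [:: p; q; f] by rewrite /= !inE !negb_or !(eq_sym p) qp fp eq_sym fq.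
have cutE : [:: p; q; f] =i cut X.
  apply/subset_cardP; first by rewrite cX; apply/card_uniqP.
  by apply/subsetP => h; rewrite !in_cons orbF => /or3P[]/eqP->.
have parity M : perfect_matching ends M -> odd ((p \in M) + ((q \in M) + (f \in M))).
  move=> /(odd_cut_perfect_matching X); rewrite oX.
  have -> : #|M :&: cut X| = #|[seq g <- [:: p; q; f] | g \in M]|.
    by apply: eq_card => g; rewrite in_setI -cutE mem_filter.
  by rewrite (card_uniqP (filter_uniq _ uniq_pqf)) size_filter /= addn0.
move: (parity A PA) (parity B PB) (parity C PC).
rewrite pC pA (negPf pB) qB qC (negPf qA).
by case: (f \in A); case: (f \in B); case: (f \in C).
Qed.

(** [M'] trades the edges [p], [q] for [e], which spoils the degree only at [x] and [z]. These lie
    in [X] and [Z], where [Mx] and [Mz] are used instead. The agreement hypotheses make the glued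
    set coincide with a single one of the three around each vertex. *)
Lemma switch_matching M Mx Mz (X Z : {set V}) (e p q : E) (u w x z : V) :
  perfect_matching ends M -> perfect_matching ends Mx -> perfect_matching ends Mz ->
  joins e u w -> joins p u x -> joins q w z -> e \notin M -> p \in M -> q \in M -> p != q ->
  x \in X -> z \in Z -> u \notin X :|: Z -> w \notin X :|: Z -> [disjoint X & Z] ->
  let M' := e |: (M :\ p :\ q) in
  (forall f a b, joins f a b -> a \in X -> b \in Z -> (f \in Mx) = (f \in Mz)) ->
  (forall f a b, joins f a b -> a \in X -> b \notin X :|: Z -> (f \in Mx) = (f \in M')) ->
  (forall f a b, joins f a b -> a \in Z -> b \notin X :|: Z -> (f \in Mz) = (f \in M')) ->
  perfect_matching ends
    [set f | if 0 < nends f X then f \in Mx else if 0 < nends f Z then f \in Mz else f \in M'].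
Proof.
move=> PM PMx PMz eJ pJ qJ eM pM qM pq xX zZ uXZ wXZ XZ M' hXZ hX hZ v.
have [vX|vX] := boolP (v \in X).
  rewrite (eq_sdeg (M := Mx)) // => f /inc_gt0P[b fJ].
  by rewrite inE (joins_nends _ fJ) vX.
have [vZ|vZ] := boolP (v \in Z).
  rewrite (eq_sdeg (M := Mz)) // => f /inc_gt0P[b fJ].
  rewrite inE !(joins_nends _ fJ) (negPf vX) vZ add0n lt0b; case: ifP => // bX.
  by apply: hXZ bX vZ; rewrite joinsC.
have vXZ : v \notin X :|: Z by rewrite inE negb_or vX.
rewrite (eq_sdeg (M := M')) => [|f /inc_gt0P[b fJ]].
  have eM' : e \notin M :\ p :\ q by rewrite !inE (negPf eM) !andbF.
  have qMp : q \in M :\ p by rewrite !inE eq_sym pq.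
  rewrite sdegU1 //; have := PM v; rewrite (sdegD1 v pM) (sdegD1 v qMp).
  rewrite (joins_inc _ eJ) (joins_inc _ pJ) (joins_inc _ qJ).
  have -> : (x == v) = false by apply: contraNF vX => /eqP<-.
  have -> : (z == v) = false by apply: contraNF vZ => /eqP<-.
  by rewrite !addn0 addnA.
rewrite inE !(joins_nends _ fJ) (negPf vX) (negPf vZ) !add0n !lt0b.
rewrite joinsC in fJ; case: ifP => [bX|_]; first exact: hX fJ bX vXZ.
by case: ifP => // bZ; apply: hZ fJ bZ vXZ.
Qed.

Lemma hexagon_uncovered M1 M2 M3 v0 v1 v2 v3 v4 v5 e01 e12 e23 e34 e45 e50 :
  hexagon M1 M2 M3 v0 v1 v2 v3 v4 v5 e01 e12 e23 e34 e45 e50 ->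
  [/\ e01 \notin M1, e01 \notin M2 & e01 \notin M3].
Proof.
move=> H; have : e01 \in [set e01; e23; e45] by rewrite !inE eqxx.
by rewrite -(hex_uncovered H) !inE !negb_or => /andP[/andP[-> ->] ->].
Qed.

Lemma cut_ear M1 M2 M3 v0 v1 v2 v3 v4 v5 e01 e12 e23 e34 e45 e50 X f :
  hexagon M1 M2 M3 v0 v1 v2 v3 v4 v5 e01 e12 e23 e34 e45 e50 ->
  ear v0 v1 v2 v3 v4 v5 X -> f \in cut X ->
  [\/ f = e50, f = e34 | [/\ f \notin M1, f \notin M2 & f \in M3]].
Proof.
move=> H /and5P[cX x4 x5 x0 /and3P[x1 x2 x3]] fX.
have [->|f50] := eqVneq f e50; first exact: Or31.
have [->|f34] := eqVneq f e34; first exact: Or32.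
have [PM1 PM2 PM3] := hex_matching H.
apply/Or33/(third_cut_edge PM1 PM2 PM3 cX _ _ fX (hex50_in H) (hex34_in H) f50 f34).
  by rewrite (joins_cut _ (hex50 H)) x5 (negPf x0).
by rewrite (joins_cut _ (hex34 H)) x4 (negPf x3).
Qed.

(* Recolouring the hexagon with two ears: [M2] is used on [X], [M3] on [Z], and
   elsewhere [M1] is rotated around the hexagon so as to pick up [e01]. *)
Lemma ear_switch M1 M2 M3 v0 v1 v2 v3 v4 v5 e01 e12 e23 e34 e45 e50 X Y Z :
  hexagon M1 M2 M3 v0 v1 v2 v3 v4 v5 e01 e12 e23 e34 e45 e50 ->
  ear v0 v1 v2 v3 v4 v5 X -> ear v4 v5 v0 v1 v2 v3 Z ->
  [disjoint X & Y] -> [disjoint Y & Z] -> [disjoint Z & X] ->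
  exists N, [/\ perfect_matching ends N, e01 \in N,
    forall f, f \in M2 -> 0 < nends f X -> f \in N,
    forall f, f \in M3 -> 0 < nends f Z -> f \in N &
    forall f, f \in M1 -> (nends f X = 0 /\ nends f Z = 0) \/
      [/\ f \notin M2, f \notin M3 & 0 < nends f Y] -> f \in N].
Proof.
move=> H earX earZ XY YZ ZX; have [PM1 PM2 PM3] := hex_matching H.
have H2 := hexagon_rot (hexagon_rot H).
have [n1 n2 n3] := hexagon_uncovered H.
have [d1 d2 d3] := hex12_in H; have [d'2 d'3 d'1] := hex34_in H; have [d''3 d''1 d''2] := hex50_in H.
have /and5P[_ x4 x5 x0 /and3P[x1 x2 x3]] := earX.
have /and5P[_ z2 z3 z4 /and3P[z5 z0 z1]] := earZ.
have cutX f a b : joins f a b -> a \in X -> b \notin X -> f \in cut X.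
  by move=> fJ aX bX; rewrite (joins_cut _ fJ) aX (negPf bX).
have cutZ f a b : joins f a b -> a \in Z -> b \notin Z -> f \in cut Z.
  by move=> fJ aX bX; rewrite (joins_cut _ fJ) aX (negPf bX).
have disj (A B : {set V}) v : [disjoint A & B] -> v \in A -> v \notin B by move=> /disjointFr h /h->.
have typeX f : f \in cut X -> [|| [&& f \in M1, f \notin M2 & f \in M3],
    [&& f \notin M1, f \in M2 & f \in M3] | [&& f \notin M1, f \notin M2 & f \in M3]].
  by move=> /(cut_ear H earX)[->|->|[-> -> ->]]; rewrite ?d''1 ?d''2 ?d''3 ?d'1 ?d'2 ?d'3 ?orbT.
have typeZ f : f \in cut Z -> [|| [&& f \notin M1, f \in M2 & f \in M3],
    [&& f \in M1, f \in M2 & f \notin M3] | [&& f \notin M1, f \in M2 & f \notin M3]].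
  by move=> /(cut_ear H2 earZ)[->|->|[-> -> ->]]; rewrite ?d1 ?d2 ?d3 ?d'1 ?d'2 ?d'3 ?orbT.
have no34 f a b : joins f a b -> b \notin X :|: Z -> f != e34.
  move=> fJ /negPf bXZ; apply/eqP => fE; have := joins_nends (X :|: Z) fJ.
  by rewrite bXZ fE (joins_nends _ (hex34 H)) !inE x4 z3 orbT addn0 /=; case: (_ || _).
pose M' := e01 |: (M1 :\ e50 :\ e12).
have M'E f : (f \in M') = (f == e01) || [&& f != e12, f != e50 & f \in M1] by rewrite !inE.
have p_q : e50 != e12 by apply: contraNneq d''2 => ->.
(* Such an edge lies in both cuts, and the only membership pattern common to [typeX] and [typeZ] is
   that of [e34]: in [M2] and [M3]. *)
have hXZ f a b : joins f a b -> a \in X -> b \in Z -> (f \in M2) = (f \in M3).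
  move=> fJ aX bZ; have := typeX f (cutX f a b fJ aX (disj _ _ _ ZX bZ)).
  rewrite joinsC in fJ; rewrite disjoint_sym in ZX.
  have := typeZ f (cutZ f b a fJ bZ (disj _ _ _ ZX aX)).
  by case: (f \in M1); case: (f \in M2); case: (f \in M3).
have hX f a b : joins f a b -> a \in X -> b \notin X :|: Z -> (f \in M2) = (f \in M').
  move=> fJ aX bXZ; have f34 := no34 f a b fJ bXZ.
  have bX : b \notin X by apply: contraNN bXZ => bX; rewrite inE bX.
  rewrite M'E; case: (cut_ear H earX (cutX f a b fJ aX bX)) => [->|fE|[f1 f2 f3]].
  - rewrite (negPf d''2) eqxx andbF orbF; apply/esym/negbTE.
    by apply: contraNneq n1 => <-.
  - by rewrite fE eqxx in f34.
  rewrite (negPf f1) (negPf f2) !andbF orbF; apply/esym/negbTE.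
  by apply: contraNneq n3 => <-.
have hZ f a b : joins f a b -> a \in Z -> b \notin X :|: Z -> (f \in M3) = (f \in M').
  move=> fJ aZ bXZ; have f34 := no34 f a b fJ bXZ.
  have bZ : b \notin Z by apply: contraNN bXZ => bZ; rewrite inE bZ orbT.
  rewrite M'E; case: (cut_ear H2 earZ (cutZ f a b fJ aZ bZ)) => [fE|->|[f3 f1 f2]].
  - by rewrite fE eqxx in f34.
  - rewrite (negPf d3) eqxx orbF; apply/esym/negbTE.
    by apply: contraNneq n1 => <-.
  rewrite (negPf f1) (negPf f3) !andbF orbF; apply/esym/negbTE.
  by apply: contraNneq n2 => <-.
have v0XZ : v0 \notin X :|: Z by rewrite inE negb_or x0 z0.
have v1XZ : v1 \notin X :|: Z by rewrite inE negb_or x1 z1.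
have p0 : joins e50 v0 v5 by rewrite joinsC (hex50 H).
have XZ : [disjoint X & Z] by rewrite disjoint_sym.
have PN := switch_matching PM1 PM2 PM3 (hex01 H) p0 (hex12 H) n1 d''1 d1 p_q x5 z2 v0XZ v1XZ XZ hXZ hX hZ.
eexists; split; first exact: PN.
- rewrite inE !(joins_nends _ (hex01 H)) (negPf x0) (negPf x1) (negPf z0) (negPf z1) /=.
  by rewrite !inE eqxx.
- by move=> f f2 fX; rewrite inE fX.
- move=> f f3 fZ; rewrite inE fZ; case: ifP => // fX.
  have fJ := joins_ends f; move: (_.1) (_.2) fJ => a b fJ.
  move: fX fZ; rewrite !(joins_nends _ fJ).
  case: (boolP (a \in X)) => aX.
    rewrite (negPf (disj _ _ _ XZ aX)) lt0b => _ bZ.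
    by rewrite (hXZ f a b).
  rewrite lt0b => bX; rewrite (negPf (disj _ _ _ XZ bX)) addn0 lt0b => aZ.
  by rewrite (hXZ f b a) // joinsC.
move=> f f1 [[fX fZ]|[f2 f3 fY]]; rewrite inE.
  rewrite fX fZ /= M'E f1 andbT; apply/orP; right; apply/andP; split.
    by apply/eqP => fE; move: fZ; rewrite fE (joins_nends _ (hex12 H)) z2 addn1.
  by apply/eqP => fE; move: fX; rewrite fE (joins_nends _ (hex50 H)) x5.
have [a [b [fJ aY]]] : exists a b, joins f a b /\ a \in Y.
  have fJ := joins_ends f; case: (boolP ((ends f).1 \in Y)) => aY; first by exists (ends f).1, (ends f).2.
  exists (ends f).2, (ends f).1; rewrite joinsC fJ; move: fY.
  by rewrite /nends (negPf aY) lt0b.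
have aX : a \notin X by apply: disj aY; rewrite disjoint_sym.
have aZ : a \notin Z by apply: disj aY.
rewrite !(joins_nends _ fJ) (negPf aX) (negPf aZ) !add0n !lt0b.
rewrite joinsC in fJ.
(* Every cut edge of [X] is in [M3] and every cut edge of [Z] in [M2], so an edge of [M1] alone that
   touches [Y] reaches neither ear. *)
case: ifP => [bX|_]; first by have := typeX f (cutX f b a fJ bX aX); rewrite f1 (negPf f2) (negPf f3).
case: ifP => [bZ|_]; first by have := typeZ f (cutZ f b a fJ bZ aZ); rewrite f1 (negPf f2) (negPf f3).
rewrite M'E f1 andbT; apply/orP; right; apply/andP; split.
  by apply: contraNneq f2 => ->.
by apply: contraNneq f3 => ->.
Qed.

(** The three rotated switches together exchange [M1] with [M2] on [X], [M2] with [M3] on [Y], and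
    [M3] with [M1] on [Z], and each picks up one uncovered edge. *)
Lemma three_ears_colourable M1 M2 M3 v0 v1 v2 v3 v4 v5 e01 e12 e23 e34 e45 e50 X Y Z :
  hexagon M1 M2 M3 v0 v1 v2 v3 v4 v5 e01 e12 e23 e34 e45 e50 ->
  ear v0 v1 v2 v3 v4 v5 X -> ear v2 v3 v4 v5 v0 v1 Y -> ear v4 v5 v0 v1 v2 v3 Z ->
  [disjoint X & Y] -> [disjoint Y & Z] -> [disjoint Z & X] ->
  exists N1 N2 N3, [/\ perfect_matching ends N1, perfect_matching ends N2,
    perfect_matching ends N3 & uncovered N1 N2 N3 = 0].
Proof.
move=> H earX earY earZ XY YZ ZX.
have H1 := hexagon_rot H; have H2 := hexagon_rot H1.
have [N1 [PN1 n1 N1X N1Z N1Y]] := ear_switch H earX earZ XY YZ ZX.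
have [N2 [PN2 n2 N2Y N2X N2Z]] := ear_switch H1 earY earX YZ ZX XY.
have [N3 [PN3 n3 N3Z N3Y N3X]] := ear_switch H2 earZ earY ZX XY YZ.
exists N1, N2, N3; split=> //; apply/eqP; rewrite /uncovered cards_eq0; apply/eqP/setP => f.
rewrite !inE; apply/negbTE; rewrite negbK.
have [fU|] := boolP (f \in [set e01; e23; e45]).
  by move: fU; rewrite !inE -orbA => /or3P[]/eqP->; rewrite ?n1 ?n2 ?n3 ?orbT.
rewrite -(hex_uncovered H) !inE negbK.
(* The third case may assume that the first two fail, as the last clause of [ear_switch] requires
   for edges touching the remaining ear. *)
have covered (P1 P2 P3 : bool) : [|| P1, P2 | P3] -> (P1 -> (f \in N1) || (f \in N2) || (f \in N3)) ->
  (P2 -> (f \in N1) || (f \in N2) || (f \in N3)) ->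
  (~~ P1 -> ~~ P2 -> P3 -> (f \in N1) || (f \in N2) || (f \in N3)) ->
  (f \in N1) || (f \in N2) || (f \in N3).
  by case: P1 P2 P3 => [] [] [] //= _ h1 h2 h3; auto.
rewrite -orbA => fM; have [fX0|fX] := posnP (nends f X); last first.
  apply: covered fM _ _ _ => [f1|f2|f1 f2 f3]; first by rewrite N2X ?orbT.
    by rewrite N1X.
  by rewrite N3X ?orbT //; right.
have [fY0|fY] := posnP (nends f Y); last first.
  rewrite orbC -orbA in fM; apply: covered fM _ _ _ => [f2|f3|f2 f3 f1]; first by rewrite N3Y ?orbT.
    by rewrite N2Y ?orbT.
  by rewrite N1Y //; right.
have [fZ0|fZ] := posnP (nends f Z); last first.
  rewrite orbA orbC in fM; apply: covered fM _ _ _ => [f3|f1|f3 f1 f2]; first by rewrite N1Z.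
    by rewrite N3Z ?orbT.
  by rewrite N2Z ?orbT //; right.
case/or3P: fM => [f1|f2|f3].
- by rewrite N1Y //; left.
- by rewrite N2Z ?orbT //; left.
by rewrite N3X ?orbT //; left.
Qed.

(** * The uncovered edges of an optimal triple *)

Lemma joins_neq e f x y z t :
  joins e x y -> joins f z t -> x != z -> x != t -> e != f.
Proof.
move=> je jf xz xt; apply/eqP => ef; move: (joins_inc x je); rewrite ef (joins_inc x jf).
by rewrite !(eq_sym _ x) eqxx (negPf xz) (negPf xt).
Qed.

Lemma inc_l e x y : joins e x y -> 0 < inc e x.
Proof. by move=> je; rewrite (joins_inc _ je) eqxx. Qed.

Lemma inc_r e x y : joins e x y -> 0 < inc e y.
Proof. by rewrite joinsC; apply: inc_l. Qed.

Lemma inc_off e x y w : joins e x y -> x != w -> y != w -> (0 < inc e w) = false.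
Proof. by move=> je /negPf xw /negPf yw; rewrite (joins_inc _ je) xw yw. Qed.

Lemma sdeg_seq (s : seq E) v : uniq s -> sdeg [set e in s] v = \sum_(e <- s) inc e v.
Proof. by move=> us; rewrite sdegE [RHS]big_uniq //=; apply: eq_bigl => e; rewrite inE. Qed.

Lemma swap_uncovers M1 M2 M3 (s t : seq E) a :
  perfect_matching ends M1 ->
  (forall N, perfect_matching ends N -> uncovered M1 M2 M3 <= uncovered N M2 M3) ->
  uniq s -> uniq t -> (forall v, \sum_(e <- s) inc e v = \sum_(e <- t) inc e v) ->
  {in s, forall e, e \in M1 /\ (e \in M2) || (e \in M3)} ->
  {in t, forall e, e \in ~: (M1 :|: M2 :|: M3)} -> a \in t -> False.
Proof.
move=> PM Mmin us ut st sP tP aT.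
pose S := [set e in s]; pose T := [set e in t].
have SM : S \subset M1 by apply/subsetP => e; rewrite inE => /sP[].
have dis : [disjoint M1 :\: S & T].
  rewrite disjoint_sym disjoints_subset; apply/subsetP => e; rewrite !inE => /tP.
  by rewrite !inE !negb_or => /andP[/andP[/negPf-> _] _]; rewrite andbF.
have disS : [disjoint M1 :\: S & S] by rewrite disjoints_subset; apply/subsetP => e; rewrite !inE => /andP[].
have PN : perfect_matching ends (M1 :\: S :|: T).
  move=> v; rewrite sdegU // sdeg_seq // -st -sdeg_seq // -sdegU //.
  suff -> : M1 :\: S :|: S = M1 by apply: PM.
  by rewrite setUC -{1}(setIidPr SM) setID.
have := Mmin _ PN; rewrite leqNgt => /negP; apply; apply: proper_card.
apply/properP; split.
  apply/subsetP => e; rewrite !inE !negb_or => /andP[/andP[/andP[eS _] e2] e3].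
  rewrite e2 e3 !andbT; apply: contra eS => e1; rewrite e1 andbT.
  by apply/negP => /sP[_]; rewrite (negPf e2) (negPf e3).
by exists a; [apply: tP | rewrite !inE aT orbT].
Qed.

Section Core.
Variables M1 M2 M3 : {set E}.
Hypotheses (PM1 : perfect_matching ends M1) (PM2 : perfect_matching ends M2)
  (PM3 : perfect_matching ends M3).

(** Value 0 means uncovered; edges of value at least 2 are called heavy. *)
Definition mult e : nat := (e \in M1) + (e \in M2) + (e \in M3).

Lemma star_mult v : exists e f g, [/\ uniq [:: e; f; g],
  forall x, (0 < inc x v) = (x \in [:: e; f; g]) & mult e + mult f + mult g = 3].
Proof.
have inc1 x : inc x v = (x \in [set x | 0 < inc x v]).
  rewrite inE; have := cubic_loopless (joins_ends x); rewrite /inc.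
  by case: (eqVneq (ends x).1 v) => [->|_]; [rewrite eq_sym => /negPf-> | move=> _; case: eqP].
have sum_star F : sdeg F v = \sum_(x <- enum [set x | 0 < inc x v]) (x \in F).
  rewrite big_enum sdegE big_mkcond [RHS]big_mkcond; apply: eq_bigr => x _.
  by rewrite inc1; do 2!case: (_ \in _).
have := cubicG v; rewrite sum_star (eq_bigr (fun=> 1)) => [|x _]; last by rewrite in_setT.
have := PM1 v; have := PM2 v; have := PM3 v; rewrite !sum_star.
have := mem_enum [set x | 0 < inc x v]; have := enum_uniq [set x | 0 < inc x v].
move: (enum _) => s us ms s3 s2 s1; rewrite sum1_size.
case: s us ms s3 s2 s1 => [|e [|f [|g []]]] // us ms s3 s2 s1 _; exists e, f, g; split=> //.
  by move=> x; rewrite ms inE.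
by move: s3 s2 s1; rewrite /mult !big_cons !big_nil; nlia.
Qed.

Lemma star_mult_at e v : 0 < inc e v -> exists f g, [/\ uniq [:: e; f; g],
  0 < inc f v, 0 < inc g v, forall x, 0 < inc x v -> x \in [:: e; f; g] &
  mult e + mult f + mult g = 3].
Proof.
have [x [y [z [u_xyz starE <-]]]] := star_mult v => ev.
have [xv yv zv] : [/\ 0 < inc x v, 0 < inc y v & 0 < inc z v].
  by rewrite !starE !inE !eqxx !orbT.
move: (u_xyz); rewrite /= !inE negb_or andbT => /andP[/andP[xy xz] yz].
move: (ev); rewrite starE !inE => /or3P[] /eqP ->.
- by exists y, z; split=> // g; rewrite starE.
- exists x, z; split=> //; last by rewrite (addnC (mult y)).
    by rewrite /= !inE negb_or andbT eq_sym xy yz xz.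
  by move=> g; rewrite starE !inE orbCA.
exists x, y; split=> //; last by rewrite -addnA addnC.
  by rewrite /= !inE negb_or andbT eq_sym xz eq_sym yz xy.
by move=> g; rewrite starE !inE orbA orbC.
Qed.

(** The three values at a vertex sum to 3, so a 0 forces a heavy edge and conversely: uncovered and
    heavy edges can be followed alternately. *)
Lemma uncovered_heavy e v : mult e = 0 -> 0 < inc e v ->
  exists f w, 1 < mult f /\ joins f v w.
Proof.
move=> e0 /star_mult_at[f [g [_ /inc_gt0P[y fJ] /inc_gt0P[z gJ] _]]]; rewrite e0 add0n => sum3.
have [f2|f1] := ltnP 1 (mult f); first by exists f, y.
by exists g, z; split=> //; move: f1 sum3; move: (mult f) (mult g); nlia.
Qed.

Lemma heavy_uncovered f v : 1 < mult f -> 0 < inc f v ->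
  exists e w, mult e = 0 /\ joins e v w.
Proof.
move=> f2 /star_mult_at[e [g [_ /inc_gt0P[y eJ] /inc_gt0P[z gJ] _]]] sum3.
have [e0|e1] := posnP (mult e); first by exists e, y.
by exists g, z; split=> //; move: f2 e1 sum3; move: (mult f) (mult g) (mult e); nlia.
Qed.

Lemma heavy_unique f g v : 1 < mult f -> 1 < mult g -> 0 < inc f v -> 0 < inc g v -> f = g.
Proof.
move=> f2 g2 /star_mult_at[x [y [_ _ _ starE sum3]]] /starE.
rewrite !inE => /or3P[]/eqP gE //; move: f2 g2 sum3; rewrite gE.
  by move: (mult f) (mult x) (mult y); nlia.
by move: (mult f) (mult x) (mult y); nlia.
Qed.

Lemma mult_le3 e : mult e <= 3.
Proof. by rewrite /mult; do 3!case: (_ \in _). Qed.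

Lemma heavy_mult3 e e' f v : mult e = 0 -> mult e' = 0 -> e != e' ->
  0 < inc e v -> 0 < inc e' v -> 1 < mult f -> 0 < inc f v -> mult f = 3.
Proof.
move=> e0 e'0 ee' ev e'v f2 /star_mult_at[x [y [_ _ _ starE]]].
have notf g : mult g = 0 -> g == f = false by move=> g0; apply/eqP => gf; rewrite -gf g0 in f2.
move: (starE e ev) (starE e' e'v); rewrite !inE !notf //=.
move=> /orP[]/eqP eE /orP[]/eqP e'E; rewrite -?eE -?e'E ?e0 ?e'0 ?addn0 //;
  by rewrite eE e'E eqxx in ee'.
Qed.

Lemma mult3_uncovered f v : mult f = 3 -> 0 < inc f v ->
  exists e e', [/\ e != e', mult e = 0, mult e' = 0, 0 < inc e v & 0 < inc e' v].
Proof.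
move=> f3 /star_mult_at[x [y [/= /and3P[_ + _] xv yv _]]].
rewrite inE f3 => xy /eqP; rewrite -addnA -[X in _ == X]addn0 eqn_add2l addn_eq0.
by move=> /andP[/eqP x0 /eqP y0]; exists x, y.
Qed.

Lemma mult0E e : (mult e == 0) = (e \in ~: (M1 :|: M2 :|: M3)).
Proof. by rewrite !inE !negb_or /mult; do 3!case: (_ \in _). Qed.

Hypothesis defect3 : uncovered M1 M2 M3 = 3.
Hypothesis optimal : forall N1 N2 N3, perfect_matching ends N1 -> perfect_matching ends N2 ->
  perfect_matching ends N3 -> 3 <= uncovered N1 N2 N3.

(** Equal incidence sums encode an alternating closed walk. A heavy edge dropped from one matching
    remains in another, so if one matching contained all of [s], switching it would beat the
    optimum. *)
Lemma no_alternating (s t : seq E) a :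
  uniq s -> uniq t -> (forall v, \sum_(e <- s) inc e v = \sum_(e <- t) inc e v) ->
  {in s, forall e, 1 < mult e} -> {in t, forall e, mult e = 0} -> a \in t ->
  [/\ ~~ all (mem M1) s, ~~ all (mem M2) s & ~~ all (mem M3) s].
Proof.
move=> us ut st s2 t0 aT.
have tO e : e \in t -> e \in ~: (M1 :|: M2 :|: M3) by rewrite -mult0E => /t0->.
split; apply/negP => /allP sM.
- apply: (swap_uncovers (M2 := M2) (M3 := M3) PM1 _ us ut st _ tO aT) => [N PN|e es].
    by rewrite defect3; apply: optimal.
  have := s2 e es; have := sM e es; rewrite /= /mult => ->.
  by case: (e \in M2); case: (e \in M3).
- have E2 : M2 :|: M1 :|: M3 = M1 :|: M2 :|: M3 by rewrite (setUC M2).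
  rewrite -E2 in tO; apply: (swap_uncovers PM2 _ us ut st _ tO aT) => [N PN|e es].
    by rewrite /uncovered E2 [X in X <= _]defect3; apply: optimal.
  have := s2 e es; have := sM e es; rewrite /= /mult => ->.
  by case: (e \in M1); case: (e \in M3).
have E3 : M3 :|: M1 :|: M2 = M1 :|: M2 :|: M3 by rewrite -setUA setUC.
rewrite -E3 in tO; apply: (swap_uncovers PM3 _ us ut st _ tO aT) => [N PN|e es].
  by rewrite /uncovered E3 [X in X <= _]defect3; apply: optimal.
have := s2 e es; have := sM e es; rewrite /= /mult => ->.
by case: (e \in M1); case: (e \in M2).
Qed.

Lemma no_parallel a d x y : mult a = 0 -> 1 < mult d -> joins a x y -> joins d x y -> False.
Proof.
move=> a0 d2 ja jd; case: (@no_alternating [:: d] [:: a] a) => //.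
- by move=> v; rewrite !big_seq1 (joins_inc _ ja) (joins_inc _ jd).
- by move=> e; rewrite inE => /eqP->.
- by move=> e; rewrite inE => /eqP->.
- by rewrite inE.
by move: d2; rewrite /mult /=; do 3!case: (_ \in _).
Qed.

(** Two heavy edges each avoid at most one of the three matchings, hence share one. Only with three
    heavy edges can a common matching fail to exist. *)
Lemma no_square a b d d' x y z t : mult a = 0 -> mult b = 0 -> 1 < mult d -> 1 < mult d' ->
  joins a x y -> joins d y z -> joins b z t -> joins d' t x -> a != b -> d != d' -> False.
Proof.
move=> a0 b0 d2 d'2 ja jd jb jd' ab dd'; case: (@no_alternating [:: d; d'] [:: a; b] a) => //.
- by rewrite /= inE dd'.
- by rewrite /= inE ab.
- move=> v; rewrite !big_cons !big_nil (joins_inc _ ja) (joins_inc _ jb) (joins_inc _ jd) (joins_inc _ jd').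
  by move: (x == v) (y == v) (z == v) (t == v); nlia.
- by move=> e; rewrite !inE => /orP[]/eqP->.
- by move=> e; rewrite !inE => /orP[]/eqP->.
- by rewrite !inE eqxx.
by move: d2 d'2; rewrite /mult /=; do 6!case: (_ \in _).
Qed.

Lemma no_four_uncovered a b c d : mult a = 0 -> mult b = 0 -> mult c = 0 -> mult d = 0 ->
  uniq [:: a; b; c; d] -> False.
Proof.
move=> a0 b0 c0 d0 us; suff : 4 <= uncovered M1 M2 M3 by rewrite defect3.
rewrite -[4]/(size [:: a; b; c; d]) -(card_uniqP us) subset_leq_card //.
by apply/subsetP => e; rewrite -mult0E !inE => /or4P[]/eqP->; apply/eqP.
Qed.

(** An alternating walk from an uncovered edge. Early closing gives a digon, a square, or a vertex
    with two uncovered edges; in the last case the heavy edge there has value 3 and its far end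
    needs two uncovered edges too, more than three in all. *)
Lemma core_hexagon : exists v0 v1 v2 v3 v4 v5 e01 e12 e23 e34 e45 e50,
  [/\ uniq [:: v0; v1; v2; v3; v4; v5],
      [/\ joins e01 v0 v1, joins e23 v2 v3, joins e45 v4 v5 &
          ~: (M1 :|: M2 :|: M3) = [set e01; e23; e45]],
      [/\ joins e12 v1 v2, joins e34 v3 v4 & joins e50 v5 v0],
      [/\ mult e12 = 2, mult e34 = 2 & mult e50 = 2] &
      let s := [:: e12; e34; e50] in
      [/\ ~~ all (mem M1) s, ~~ all (mem M2) s & ~~ all (mem M3) s]].
Proof.
have /card_gt0P[a] : 0 < #|~: (M1 :|: M2 :|: M3)| by move: defect3; rewrite /uncovered => ->.
rewrite -mult0E => /eqP a0.
have := joins_ends a; move: (_.1) (_.2) => v0 v1 ja; have n01 := cubic_loopless ja.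
have [d [v2 [d2 jd]]] := uncovered_heavy a0 (inc_r ja); have n12 := cubic_loopless jd.
have n02 : v0 != v2.
  by apply/eqP => vv; rewrite -vv joinsC in jd; apply: no_parallel a0 d2 ja jd.
have [b [v3 [b0 jb]]] := heavy_uncovered d2 (inc_r jd); have n23 := cubic_loopless jb.
have ab : a != b by rewrite eq_sym; apply: joins_neq jb ja _ _; rewrite eq_sym.
have n13 : v1 != v3.
  by apply/eqP => vv; rewrite -vv joinsC in jb; apply: no_parallel b0 d2 jb jd.
have n03 : v0 != v3.
  apply/eqP => vv; rewrite -vv in jb.
  have [f [v4 [f2 jf]]] := uncovered_heavy a0 (inc_l ja); have n04 := cubic_loopless jf.
  have f3 := heavy_mult3 a0 b0 ab (inc_l ja) (inc_r jb) f2 (inc_l jf).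
  have [e [e' [ee' e0 e'0 ev e'v]]] := mult3_uncovered f3 (inc_r jf).
  have fd : f != d by apply: joins_neq jf jd _ _.
  have n14 : v1 != v4.
    apply: contraNneq fd => ww; rewrite -ww in jf.
    by rewrite (heavy_unique f2 d2 (inc_r jf) (inc_l jd)).
  have n24 : v2 != v4.
    apply: contraNneq fd => ww; rewrite -ww in jf.
    by rewrite (heavy_unique f2 d2 (inc_r jf) (inc_r jd)).
  have aoff g : 0 < inc g v4 -> a != g.
    by apply: contraTneq => <-; rewrite (inc_off ja).
  have boff g : 0 < inc g v4 -> b != g.
    by apply: contraTneq => <-; rewrite (inc_off jb).
  apply: (no_four_uncovered a0 b0 e0 e'0).
  by rewrite /= !inE !negb_or ab ee' !aoff ?boff.
have [d' [v4 [d'2 jd']]] := uncovered_heavy b0 (inc_r jb); have n34 := cubic_loopless jd'.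
have d'd : d' != d by apply: joins_neq jd' jd _ _; rewrite eq_sym.
have n14 : v1 != v4.
  apply: contraNneq d'd => vv; rewrite -vv in jd'.
  by rewrite (heavy_unique d'2 d2 (inc_r jd') (inc_l jd)).
have n24 : v2 != v4.
  apply: contraNneq d'd => vv; rewrite -vv in jd'.
  by rewrite (heavy_unique d'2 d2 (inc_r jd') (inc_r jd)).
have n04 : v0 != v4.
  apply/eqP => vv; rewrite -vv in jd'; rewrite eq_sym in d'd.
  exact: no_square a0 b0 d2 d'2 ja jd jb jd' ab d'd.
have [c [v5 [c0 jc]]] := heavy_uncovered d'2 (inc_r jd'); have n45 := cubic_loopless jc.
have ac : a != c by rewrite eq_sym; apply: joins_neq jc ja _ _; rewrite eq_sym.
have bc : b != c by rewrite eq_sym; apply: joins_neq jc jb _ _; rewrite eq_sym.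
have O3 e : mult e = 0 -> e \in [:: a; b; c].
  move=> e0; apply: contraT => eO; case: (no_four_uncovered e0 a0 b0 c0).
  by rewrite cons_uniq eO /= !inE negb_or ab ac bc.
have lone w x f : mult f = 3 -> 0 < inc f w ->
    (forall e, e \in [:: a; b; c] -> 0 < inc e w -> e = x) -> False.
  move=> f3 fw only; have [e [e' [ee' /O3 e0 /O3 e'0 ew e'w]]] := mult3_uncovered f3 fw.
  by rewrite (only e e0 ew) (only e' e'0 e'w) eqxx in ee'.
have heavy_off f v w : 1 < mult f -> joins f v w -> f != d -> f != d' ->
    [/\ v1 != w, v2 != w, v3 != w & v4 != w].
  move=> f2 jf fd fd'; split.
  - apply: contraNneq fd => vv; rewrite -vv in jf.
    by rewrite (heavy_unique f2 d2 (inc_r jf) (inc_l jd)).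
  - apply: contraNneq fd => vv; rewrite -vv in jf.
    by rewrite (heavy_unique f2 d2 (inc_r jf) (inc_r jd)).
  - apply: contraNneq fd' => vv; rewrite -vv in jf.
    by rewrite (heavy_unique f2 d'2 (inc_r jf) (inc_l jd')).
  apply: contraNneq fd' => vv; rewrite -vv in jf.
  by rewrite (heavy_unique f2 d'2 (inc_r jf) (inc_r jd')).
have n05 : v0 != v5.
  apply/eqP => vv; rewrite -vv in jc.
  have [f [v6 [f2 jf]]] := uncovered_heavy a0 (inc_l ja); have n06 := cubic_loopless jf.
  have f3 := heavy_mult3 a0 c0 ac (inc_l ja) (inc_r jc) f2 (inc_l jf).
  have fd : f != d by apply: joins_neq jf jd _ _.
  have fd' : f != d' by apply: joins_neq jf jd' _ _.
  have [n16 n26 n36 n46] := heavy_off f v0 v6 f2 jf fd fd'.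
  apply: (lone v6 a f f3 (inc_r jf)) => e; rewrite !inE => /or3P[]/eqP->.
  - by rewrite (inc_off ja).
  - by rewrite (inc_off jb).
  by rewrite (inc_off jc).
have n15 : v1 != v5.
  apply/eqP => vv; rewrite -vv in jc.
  have d3 := heavy_mult3 a0 c0 ac (inc_r ja) (inc_r jc) d2 (inc_l jd).
  apply: (lone v2 b d d3 (inc_r jd)) => e; rewrite !inE => /or3P[]/eqP-> //.
  - by rewrite (inc_off ja).
  by rewrite (inc_off jc) // eq_sym.
have n25 : v2 != v5.
  apply/eqP => vv; rewrite -vv in jc.
  have d3 := heavy_mult3 b0 c0 bc (inc_l jb) (inc_r jc) d2 (inc_r jd).
  apply: (lone v1 a d d3 (inc_l jd)) => e; rewrite !inE => /or3P[]/eqP-> //.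
  - by rewrite (inc_off jb) // eq_sym.
  by rewrite (inc_off jc) // eq_sym.
have n35 : v3 != v5.
  apply/eqP => vv; rewrite -vv in jc.
  have d3 := heavy_mult3 b0 c0 bc (inc_r jb) (inc_r jc) d'2 (inc_l jd').
  apply: (lone v4 c d' d3 (inc_r jd')) => e; rewrite !inE => /or3P[]/eqP-> //.
  - by rewrite (inc_off ja).
  by rewrite (inc_off jb).
have [d'' [v6 [d''2 jd'']]] := uncovered_heavy c0 (inc_r jc); have n56 := cubic_loopless jd''.
have d''d : d'' != d by apply: joins_neq jd'' jd _ _; rewrite eq_sym.
have d''d' : d'' != d' by apply: joins_neq jd'' jd' _ _; rewrite eq_sym.
have [n16 n26 n36 n46] := heavy_off d'' v5 v6 d''2 jd'' d''d d''d'.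
(* An uncovered edge must meet the heavy edge [d''] at [v6]. Only [a], [b], [c] exist, and [v6]
   differs from [v1] to [v5], so it is [v0]. *)
have E06 : v0 = v6.
  apply/eqP; apply: contraT => n06.
  have [e [w [/O3 e0 /inc_l ev]]] := heavy_uncovered d''2 (inc_r jd'').
  move: e0; rewrite !inE => /or3P[]/eqP eE; move: ev; rewrite eE.
  - by rewrite (inc_off ja).
  - by rewrite (inc_off jb).
  by rewrite (inc_off jc).
rewrite -{v6}E06 in jd'' n56 n16 n26 n36 n46.
have mult2 f : 1 < mult f -> mult f <> 3 -> mult f = 2.
  by have := mult_le3 f; case: (mult f) => [|[|[|[|]]]].
exists v0, v1, v2, v3, v4, v5, a, d, b, d', c, d''; split.
- by rewrite /= !inE !negb_or n01 n02 n03 n04 n05 n12 n13 n14 n15 n23 n24 n25 n34 n35 n45.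
- split=> //; apply/setP => e; rewrite -mult0E [RHS]inE [X in X || _]inE !in_set1 -orbA.
  apply/eqP/idP => [/O3|/or3P[]/eqP->//]; by rewrite !inE.
- by [].
- split; apply: mult2 => // f3.
  + apply: (lone v1 a d f3 (inc_l jd)) => e; rewrite !inE => /or3P[]/eqP-> //.
    * by rewrite (inc_off jb) // eq_sym.
    by rewrite (inc_off jc) // eq_sym.
  + apply: (lone v3 b d' f3 (inc_l jd')) => e; rewrite !inE => /or3P[]/eqP-> //.
    * by rewrite (inc_off ja).
    by rewrite (inc_off jc) // eq_sym.
  apply: (lone v5 c d'' f3 (inc_l jd'')) => e; rewrite !inE => /or3P[]/eqP-> //.
  * by rewrite (inc_off ja).
  by rewrite (inc_off jb).
apply: (@no_alternating _ [:: a; b; c] a).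
- by rewrite /= !inE negb_or eq_sym d'd eq_sym d''d eq_sym d''d'.
- by rewrite /= !inE negb_or ab ac bc.
- move=> v; rewrite !big_cons !big_nil (joins_inc _ ja) (joins_inc _ jb) (joins_inc _ jc).
  rewrite (joins_inc _ jd) (joins_inc _ jd') (joins_inc _ jd'').
  by move: (v0 == v) (v1 == v) (v2 == v) (v3 == v) (v4 == v) (v5 == v); nlia.
- by move=> e; rewrite !inE => /or3P[]/eqP->.
- by move=> e; rewrite !inE => /or3P[]/eqP->.
by rewrite !inE eqxx.
Qed.

(** Each heavy edge of the hexagon avoids exactly one matching and no matching contains all three,
    so the avoided ones form a permutation of [M1], [M2], [M3]; the six relabellings are tried in
    turn. *)
Lemma hexagon_exists : exists N1 N2 N3 v0 v1 v2 v3 v4 v5 e01 e12 e23 e34 e45 e50,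
  hexagon N1 N2 N3 v0 v1 v2 v3 v4 v5 e01 e12 e23 e34 e45 e50.
Proof.
have [v0 [v1 [v2 [v3 [v4 [v5 [a [d [b [d' [c [d'' [us [ja jb jc OE] [jd jd' jd''] [d2 d'2 d''2] []]]]]]]]]]]]]]
  := core_hexagon.
suff build (A B C : {set E}) :
    perfect_matching ends A -> perfect_matching ends B -> perfect_matching ends C ->
    A :|: B :|: C = M1 :|: M2 :|: M3 ->
    [&& d \in A, d \in B & d \notin C] -> [&& d' \in B, d' \in C & d' \notin A] ->
    [&& d'' \in C, d'' \in A & d'' \notin B] -> exists N1 N2 N3 v0 v1 v2 v3 v4 v5 e01 e12 e23 e34 e45 e50,
  hexagon N1 N2 N3 v0 v1 v2 v3 v4 v5 e01 e12 e23 e34 e45 e50.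
  have := d2; have := d'2; have := d''2; rewrite /mult /=.
  have E213 : M2 :|: M1 :|: M3 = M1 :|: M2 :|: M3 by rewrite (setUC M2).
  have E312 : M3 :|: M1 :|: M2 = M1 :|: M2 :|: M3 by rewrite -setUA setUC.
  have E231 : M2 :|: M3 :|: M1 = M1 :|: M2 :|: M3 by rewrite setUC setUA.
  have E132 : M1 :|: M3 :|: M2 = M1 :|: M2 :|: M3 by rewrite setUAC.
  have E321 : M3 :|: M2 :|: M1 = M1 :|: M2 :|: M3 by rewrite setUC (setUC M3) setUA.
  have B123 := build M1 M2 M3 PM1 PM2 PM3 erefl.
  have B213 := build M2 M1 M3 PM2 PM1 PM3 E213.
  have B312 := build M3 M1 M2 PM3 PM1 PM2 E312.
  have B231 := build M2 M3 M1 PM2 PM3 PM1 E231.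
  have B132 := build M1 M3 M2 PM1 PM3 PM2 E132.
  have B321 := build M3 M2 M1 PM3 PM2 PM1 E321.
  move: B123 B213 B312 B231 B132 B321 {build d2 d'2 d''2 OE E213 E312 E231 E132 E321}.
  move: (d \in M1) (d \in M2) (d \in M3) (d' \in M1) (d' \in M2) (d' \in M3);
  move: (d'' \in M1) (d'' \in M2) (d'' \in M3).
  do 3![case; case; case] => //=; by auto.
move=> PA PB PC EU /and3P[dA dB dC] /and3P[d'B d'C d'A] /and3P[d''C d''A d''B].
exists A, B, C, v0, v1, v2, v3, v4, v5, a, d, b; exists d', c, d''; split=> //.
by rewrite EU.
Qed.

End Core.

(** * Assembling the five perfect matchings *)

Lemma berge_cover_of_hexagon M1 M2 M3 v0 v1 v2 v3 v4 v5 e01 e12 e23 e34 e45 e50 M e f g :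
  hexagon M1 M2 M3 v0 v1 v2 v3 v4 v5 e01 e12 e23 e34 e45 e50 ->
  perfect_matching ends M -> e \in M -> f \in M -> [set e01; e23; e45] \subset [set e; f; g] ->
  berge_cover ends.
Proof.
move=> H PM eM fM sub; have [PM1 PM2 PM3] := hex_matching H.
(* [g] is the uncovered edge that [M] need not contain. Stating the triple as an inclusion lets [e],
   [f], [g] be any rotation of the three uncovered edges. *)
have [N PN gN] := edge_in_perfect_matching g.
exists [:: M1; M2; M3; M; N]; split=> // [L|h].
  by rewrite !inE => /or4P[/eqP->|/eqP->|/eqP->|/orP[]/eqP->].
have [hU|] := boolP (h \in [set e01; e23; e45]).
  move/(subsetP sub): hU; rewrite !inE => /orP[/orP[]|] /eqP->.
  - by exists M; rewrite // !inE eqxx !orbT.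
  - by exists M; rewrite // !inE eqxx !orbT.
  by exists N; rewrite // !inE eqxx !orbT.
rewrite -(hex_uncovered H) !inE negbK => /orP[/orP[]|] hM.
- by exists M1; rewrite // !inE eqxx.
- by exists M2; rewrite // !inE eqxx orbT.
by exists M3; rewrite // !inE eqxx !orbT.
Qed.

Lemma unmatchable_ear M1 M2 M3 v0 v1 v2 v3 v4 v5 e01 e12 e23 e34 e45 e50 :
  hexagon M1 M2 M3 v0 v1 v2 v3 v4 v5 e01 e12 e23 e34 e45 e50 ->
  (exists M, [/\ perfect_matching ends M, e01 \in M & e23 \in M]) \/
  (exists X, minimal_ear v0 v1 v2 v3 v4 v5 X).
Proof.
move=> H; have [[M PM]|[X [cX x4 x5 [x0 x1 x2 x3]]]] := odd_cut_of_unmatchable_path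
  (hex01 H) (hex12 H) (hex23 H) (hex34 H) (hex45 H) (hex50 H) (hex_uniq H); first by left; exists M.
right; apply: (@minimal_ear_exists _ _ _ _ _ _ X).
by rewrite /ear cX x4 x5 x0 x1 x2 x3.
Qed.

Lemma berge_cover_of_defect3 : colouring_defect ends 3 -> berge_cover ends.
Proof.
case=> -[L1 [L2 [L3 [PL1 PL2 PL3 L3E]]]] opt.
have [M1 [M2 [M3 [v0 [v1 [v2 [v3 [v4 [v5 [e01 [e12 [e23 [e34 [e45 [e50 H]]]]]]]]]]]]]]] :=
  hexagon_exists PL1 PL2 PL3 L3E opt.
have H1 := hexagon_rot H; have H2 := hexagon_rot H1.
have [[M [PM eM fM]]|[X minX]] := unmatchable_ear H.
  by apply: (berge_cover_of_hexagon (g := e45) H PM eM fM).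
have [[M [PM eM fM]]|[Y minY]] := unmatchable_ear H1.
  apply: (berge_cover_of_hexagon (g := e01) H PM eM fM).
  by apply/subsetP => e; rewrite !inE -orbA orbC.
have [[M [PM eM fM]]|[Z minZ]] := unmatchable_ear H2.
  apply: (berge_cover_of_hexagon (g := e23) H PM eM fM).
  by apply/subsetP => e; rewrite !inE orbC orbA.
have XY := minimal_ear_disjoint (hex50 H) minX (proj1 minY).
have YZ := minimal_ear_disjoint (hex50 H1) minY (proj1 minZ).
have ZX := minimal_ear_disjoint (hex50 H2) minZ (proj1 minX).
have [N1 [N2 [N3 [PN1 PN2 PN3 N0]]]] :=
  three_ears_colourable H (proj1 minX) (proj1 minY) (proj1 minZ) XY YZ ZX.
by have := opt _ _ _ PN1 PN2 PN3; rewrite N0.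
Qed.

End BridgelessCubic.
End Multigraph.

Theorem theorem1p1 (V E : finType) (ends : E -> V * V) :
  cubic ends -> bridgeless ends -> colouring_defect ends 3 -> berge_cover ends.
Proof. exact: berge_cover_of_defect3. Qed.
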